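(* The graph $\mathbb{D}_2$ is a tree, i.e. $\mathbb{D}_2$ is connected and contains no cycle.
   Context: An irreducible fractional number is $p/q$ with $p,q$ coprime integers ($p/q$ and $(-p)/(-q)$ represent the same irreducible fractional number; $1/0=(-1)/0=\infty$). The graph $\mathbb{D}_2$ has as vertices the irreducible fractional numbers $p/q$ with $p$ even. Two vertices $p/q$ and $r/s$ (with $\gcd(p,q)=\gcd(r,s)=1$) are connected by an edge of $\mathbb{D}_2$ if and only if $|ps-rq|=2$. *)

(* Defs.v *)
From HB Require Import structures.
From mathcomp Require Import all_boot all_order all_algebra.
From mathcomp Require Import zify.

Set Implicit Arguments.
Unset Strict Implicit.
Unset Printing Implicit Defensive.

Import Order.TTheory GRing.Theory Num.Theory.
Local Open Scope ring_scope.

(* p/q and (-p)/(-q) are the same irreducible fractional number, so each one is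
   stored through the representative (p, q) of {(p, q), (-p, -q)} such that
   q > 0, or (p, q) = (1, 0) for the number 1/0 = (-1)/0.  The lemmas
   [represents_exists], [represents_eq], [represents_even] and [D2_edgeE] show
   that this is the quotient of the coprime pairs by the sign, and that evenness
   and adjacency do not depend on the representatives. *)
Definition irreducible_pair (u : int * int) : bool :=
  coprimez u.1 u.2 && ((0 < u.2) || (u == (1, 0))).

Record frac := Frac { frac_pair : int * int; _ : irreducible_pair frac_pair }.

HB.instance Definition _ := [isSub for frac_pair].
HB.instance Definition _ := [Countable of frac by <:].

Definition numer (x : frac) : int := (frac_pair x).1.
Definition denom (x : frac) : int := (frac_pair x).2.

Definition represents (p q : int) (x : frac) : Prop :=
  (p = numer x /\ q = denom x) \/ (p = - numer x /\ q = - denom x).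

Record D2 := D2Vertex { D2_frac :> frac; _ : (2 %| numer D2_frac)%Z }.

HB.instance Definition _ := [isSub for D2_frac].
HB.instance Definition _ := [Countable of D2 by <:].

Definition D2_edge : rel D2 :=
  fun x y => `|numer x * denom y - numer y * denom x| == 2.

Definition graph_connected (V : eqType) (e : rel V) : Prop :=
  inhabited V /\ forall x y : V, exists2 s : seq V, path e x s & last x s = y.

(* [ucycle e c]: the vertices listed in [c] are pairwise distinct and each one
   is adjacent to the next one, cyclically.  In a simple graph the cycles are
   those with at least three vertices: [ucycle] also holds of the two endpoints
   of an edge. *)
Definition graph_acyclic (V : eqType) (e : rel V) : Prop :=
  ~ exists2 c : seq V, (3 <= size c)%N & ucycle e c.

Definition is_tree (V : eqType) (e : rel V) : Prop :=
  graph_connected e /\ graph_acyclic e.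

Lemma D2_edge_sym : symmetric D2_edge.
Proof. by move=> x y; rewrite /D2_edge distrC. Qed.

Lemma D2_edge_irr : irreflexive D2_edge.
Proof. by move=> x; rewrite /D2_edge subrr normr0. Qed.

Lemma represents_coprime p q x : represents p q x -> coprimez p q.
Proof.
by case: x => [[a b] h]; case/andP: (h) => /= cab _ [] [-> ->] //;
  rewrite coprimezN coprimeNz.
Qed.

Lemma represents_exists p q : coprimez p q -> exists x, represents p q x.
Proof.
move=> cpq; case: (ltrgtP q 0) => hq.
- have h : irreducible_pair (- p, - q).
    by rewrite /irreducible_pair coprimezN coprimeNz cpq oppr_gt0 hq.
  by exists (Frac h); right; rewrite /numer /denom /= !opprK.
- have h : irreducible_pair (p, q) by rewrite /irreducible_pair cpq hq.
  by exists (Frac h); left.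
- have h : irreducible_pair (1, 0) by [].
  exists (Frac h); rewrite /represents /numer /denom /= hq oppr0.
  have p1 : `|p|%N = 1%N.
    by move: cpq; rewrite hq /coprimez /gcdz /= gcdn0 eqz_nat => /eqP.
  by clear -p1; lia.
Qed.

Lemma represents_even p q x :
  represents p q x -> (2 %| p)%Z = (2 %| numer x)%Z.
Proof. by case=> -[-> _] //; rewrite !dvdzE abszN. Qed.

Lemma represents_eq p q r s x y : represents p q x -> represents r s y ->
  x = y <-> (p = r /\ q = s) \/ (p = - r /\ q = - s).
Proof.
move=> hx hy; split=> [xy|h].
  by move: hx hy; rewrite xy /represents; lia.
have {h} : (numer x = numer y /\ denom x = denom y) \/
           (numer x = - numer y /\ denom x = - denom y).
  by move: hx hy h; rewrite /represents; lia.
case: x y {hx hy} => [[a b] hx] [[c d] hy]; rewrite /numer /denom /= => h.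
apply: val_inj => /=; move: hx hy.
rewrite /irreducible_pair /= !xpair_eqE => /andP[_ hx] /andP[_ hy].
by congr pair; lia.
Qed.

Lemma D2_edgeE p q r s (x y : D2) : represents p q x -> represents r s y ->
  D2_edge x y = (`|p * s - r * q| == 2).
Proof.
rewrite /D2_edge => -[] [-> ->] -[] [-> ->]; rewrite ?mulNr ?mulrN ?opprK //;
  by rewrite -normrN opprD opprK.
Qed.

(* Main.v *)
Require Import Defs.
From mathcomp Require Import all_boot all_order all_algebra.
From mathcomp Require Import zify ring.

Set Implicit Arguments.
Unset Strict Implicit.
Unset Printing Implicit Defensive.

Import Order.TTheory GRing.Theory Num.Theory.
Local Open Scope ring_scope.

(** Rank the vertex p/q by |p| + q.  Adjacent vertices have different ranks, and
    every vertex other than 0/1 has exactly one neighbour of smaller rank.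
    Descending along these neighbours connects every vertex to 0/1, while a
    vertex of maximal rank on a cycle would have two lower neighbours.

    The neighbours of p/q correspond to the Farey neighbours of (p/2)/q with odd
    denominator.  If q > 1, the lower ones are those of denominator below q.
    There are two Farey neighbours of denominator below q; their denominators add
    up to the odd number q, so exactly one of these is odd. *)

Section RankedGraph.
Variables (V : choiceType) (e : rel V) (rank : V -> nat) (root : V).
Hypothesis e_sym : symmetric e.

Lemma ranked_graph_connected :
  (forall x, x != root -> exists2 y, e x y & (rank y < rank x)%N) ->
  graph_connected e.
Proof.
move=> desc; split; first exact: (inhabits root).
(* Paths to and from [root] are built together, so that no path has to be reversed afterwards. *)
have root_path n x : (rank x < n)%N ->
    (exists2 s, path e x s & last x s = root) /\
    (exists2 s, path e root s & last root s = x).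
  elim: n x => // n IHn x lt_xn; have [-> | /desc[y exy lt_yx]] := eqVneq x root.
    by split; exists [::].
  have [[s ps ls] [t pt lt]] := IHn y (leq_trans lt_yx lt_xn).
  split; first by exists (y :: s) => //=; rewrite exy.
  by exists (rcons t x); rewrite ?last_rcons // rcons_path pt lt e_sym.
move=> x y; have [[s ps ls] _] := root_path _ x (ltnSn _).
have [_ [t pt lt]] := root_path _ y (ltnSn _).
by exists (s ++ t); rewrite ?last_cat ?cat_path ?ps ls.
Qed.

Lemma ranked_graph_acyclic :
  (forall x y, e x y -> rank x != rank y) ->
  (forall x y z, e x y -> e x z -> (rank y < rank x)%N -> (rank z < rank x)%N ->
    y = z) ->
  graph_acyclic e.
Proof.
move=> rank_neq low_uniq [c c_ge3 /andP[c_cycle c_uniq]].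
have [x xc x_max] : exists2 x, x \in c & {in c, forall y, (rank y <= rank x)%N}.
  have h0 : head root c \in c by case: (c) c_ge3 => //= a l _; rewrite mem_head.
  case: (@arg_maxnP (seq_sub c) (SeqSub h0) predT (rank \o val)) => // -[x xc] _ m.
  by exists x => // y yc; apply: (m (SeqSub yc)).
case/rot_to: xc => i s def_s.
have s_ge2 : (2 <= size s)%N by rewrite -ltnS -[(size s).+1]/(size (x :: s)) -def_s size_rot.
have s_max y : y \in s -> (rank y <= rank x)%N.
  by move=> ys; apply: x_max; rewrite -(mem_rot i) def_s inE ys orbT.
move: c_cycle c_uniq; rewrite -(rot_cycle i e) -(rot_uniq i c) def_s {def_s}.
(* The cycle now starts at [x], whose two neighbours on it are the first and the last of the
   remaining vertices. They differ because at least two remain. *)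
case/lastP: s s_ge2 s_max => // s z; case: s => // y s _ s_max.
rewrite /= !rcons_path last_rcons => /and3P[exy _ ezx] /and3P[_ + _].
rewrite mem_rcons inE negb_or => /andP[/eqP yz _]; apply: yz.
have exz : e x z by rewrite e_sym.
by apply: (low_uniq x) => //; rewrite ltn_neqAle eq_sym rank_neq //=;
  apply: s_max; rewrite mem_rcons !inE eqxx ?orbT.
Qed.

End RankedGraph.

(** Coprimality with an even numerator makes the denominator odd. This excludes 1/0, so the
    denominator is positive. *)
Lemma D2_coords (x : D2) : exists a k : int,
  [/\ numer x = 2 * a, denom x = 2 * k + 1, 0 <= k & coprimez a (denom x)].
Proof.
case: x => -[[p q] h]; rewrite /numer /denom /= => p_even.
case/andP: (h) => /= cpq; rewrite xpair_eqE => hq; case/dvdzP: p_even => a def_p.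
move: cpq; rewrite def_p coprimezMl => /andP[caq c2q].
have q_odd : ~~ (2 %| q)%Z.
  by apply/negP => /dvdzP[b def_q]; case/coprimezP: c2q => -[u v] /=; lia.
exists a, (q %/ 2)%Z; split=> //; lia.
Qed.

Lemma D2_vertex_exists (a k : int) : 0 <= k -> coprimez a (2 * k + 1) ->
  exists x : D2, numer x = 2 * a /\ denom x = 2 * k + 1.
Proof.
move=> k_ge0 cak.
have h : irreducible_pair (2 * a, 2 * k + 1).
  rewrite /irreducible_pair /= coprimezMl cak andbT; apply/andP; split; last lia.
  by apply/coprimezP; exists (- k, 1) => /=; lia.
have h2 : (2 %| numer (Frac h))%Z by rewrite /numer /= dvdz_mulr.
by exists (D2Vertex h2).
Qed.

Lemma D2_eq (x y : D2) : numer x = numer y -> denom x = denom y -> x = y.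
Proof.
move=> eqn eqd; apply/val_inj/val_inj; move: eqn eqd; rewrite /numer /denom /=.
by case: (frac_pair x) (frac_pair y) => [a b] [c d] /= -> ->.
Qed.

Lemma farey_neighbour_le (a q c s : int) :
  0 < s -> s < q -> `|a * s - c * q| = 1 -> `|c| <= `|a|.
Proof.
move=> s_gt0 lt_sq asq.
have : `|c| * q <= `|a| * s + 1.
  rewrite -[q in leLHS](@gtr0_norm _ q) -1?[s in leRHS](@gtr0_norm _ s) -?normrM; lia.
(* If [|c| >= |a| + 1], then [s <= q - 1] would give [q + |a| <= 1], whereas [q >= 2]. *)
by move: `|a| `|c| (normr_ge0 a) => m n m_ge0; nia.
Qed.

Lemma farey_neighbour_cases (a q c s : int) :
  0 < q -> 0 < s -> `|a * s - c * q| = 1 ->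
  [\/ s < q /\ `|c| <= `|a|, q < s /\ `|a| <= `|c|
    | [/\ q = 1, s = 1 & `|a - c| = 1]].
Proof.
move=> q_gt0 s_gt0 asq; case: (ltrgtP s q) => [lt_sq | lt_qs | eq_sq].
- by apply: Or31; split=> //; apply: farey_neighbour_le asq.
- by apply: Or32; split=> //; apply: (@farey_neighbour_le c s a q) => //; rewrite distrC.
- apply: Or33; move: asq; rewrite eq_sq -mulrBl normrM (gtr0_norm q_gt0).
  move: `|a - c| (normr_ge0 (a - c)) => m m_ge0 mq.
  have [m0 | [m1 | m_ge2]] : m = 0 \/ m = 1 \/ 2 <= m by lia.
  + by rewrite m0 mul0r in mq.
  + by rewrite m1 mul1r in mq.
  + by nia.
Qed.

(** Eliminating [a] from the two determinants shows that [q] divides [w - s] if their signs agree,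
    and [w + s] otherwise. The bounds then force [w = s] or [w + s = q], and the latter contradicts
    parity. *)
Lemma farey_neighbour_uniq (a q c s d w : int) :
  0 < s < q -> 0 < w < q -> ~~ (2 %| q)%Z -> (2 %| s + w)%Z ->
  `|a * s - c * q| = 1 -> `|a * w - d * q| = 1 -> s = w /\ c = d.
Proof.
move=> /andP[s_gt0 lt_sq] /andP[w_gt0 lt_wq] q_odd sw_even.
set e := a * s - c * q => e1; set f := a * w - d * q => f1.
have key : q * (d * s - c * w) = e * w - f * s by rewrite /e /f; ring.
have [ef | ef] : e = f \/ e = - f by lia.
- have eq_sw : s = w.
    have : q * `|d * s - c * w| = `|w - s|.
      by rewrite -[q in LHS]gtr0_norm -?normrM ?key ?ef -?mulrBr ?normrM ?f1 ?mul1r //; lia.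
    move: `|_| (normr_ge0 (d * s - c * w)) => m m_ge0 hm.
    have [m0 | m_gt0] : m = 0 \/ 0 < m by lia.
    + by move: hm; rewrite m0 mulr0; lia.
    + by nia.
  split=> //; move: ef; rewrite /e /f eq_sw; nia.
- have : q * `|d * s - c * w| = w + s.
    rewrite -[q in LHS]gtr0_norm -?normrM ?key ?ef; last lia.
    by rewrite mulNr -opprD -mulrDr normrN normrM f1 mul1r; lia.
  move: `|_| (normr_ge0 (d * s - c * w)) => m m_ge0 hm.
  have [m0 | [m1 | m_ge2]] : m = 0 \/ m = 1 \/ 2 <= m by lia.
  + by move: hm; rewrite m0 mulr0; lia.
  + by move: hm q_odd; rewrite m1 mulr1 => ->; rewrite addrC sw_even.
  + by nia.
Qed.

Lemma farey_odd_neighbour (a k : int) :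
  0 < k -> coprimez a (2 * k + 1) ->
  exists c l : int,
    [/\ 0 <= l, l < k & `|a * (2 * l + 1) - c * (2 * k + 1)| = 1].
Proof.
set q := 2 * k + 1 => k_gt0 /coprimezP[[u v] /= uv].
have [s [c [s_gt0 lt_sq asq]]] : exists s c, [/\ 0 < s, s < q & a * s - c * q = 1].
  (* The denominator is the inverse of [a] modulo [q], reduced; it is nonzero because [q > 1]. *)
  exists (u %% q)%Z, (- v - (u %/ q)%Z * a).
  have asq : a * (u %% q)%Z - (- v - (u %/ q)%Z * a) * q = 1.
    by rewrite -uv {3}(divz_eq u q); ring.
  have q_gt0 : 0 < q by lia.
  split=> //; last exact: ltz_pmod.
  have : (u %% q)%Z != 0.
    apply/eqP => u0; move: asq; rewrite u0 mulr0 sub0r -mulNr; move: (- _) => m mq.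
    have [m_le0 | m_ge1] : m <= 0 \/ 1 <= m by lia.
    - by nia.
    - by nia.
  by have := @modz_ge0 u q; lia.
have [l [def_s | def_s]] : exists l, s = 2 * l + 1 \/ s = 2 * l.
  by exists (s %/ 2)%Z; lia.
- by exists c, l; rewrite -def_s asq; split=> //; lia.
(* If [s] is even, the complementary neighbour [(a - c) / (q - s)] has odd denominator. *)
- exists (a - c), (k - l); split; [lia | lia |].
  have -> : a * (2 * (k - l) + 1) - (a - c) * q = - (a * s - c * q).
    by rewrite def_s /q; ring.
  by rewrite asq.
Qed.

Lemma D2_edge_half (x y : D2) (a c : int) :
  numer x = 2 * a -> numer y = 2 * c ->
  D2_edge x y = (`|a * denom y - c * denom x| == 1).
Proof.
rewrite /D2_edge => -> ->; rewrite -!mulrA -mulrBr normrM; lia.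
Qed.

Definition D2_rank (x : D2) : nat := `|numer x|%N + `|denom x|%N.

Lemma D2_rank_neq (x y : D2) : D2_edge x y -> D2_rank x != D2_rank y.
Proof.
have [a [k [nx dx k_ge0 _]]] := D2_coords x.
have [c [l [ny dy l_ge0 _]]] := D2_coords y.
rewrite (D2_edge_half nx ny) /D2_rank => /eqP /farey_neighbour_cases h.
have {h} := h ltac:(lia) ltac:(lia); rewrite nx ny dx dy => -[[]|[]|[]]; lia.
Qed.

Lemma D2_lower_neighbour_uniq (x y z : D2) :
  D2_edge x y -> D2_edge x z ->
  (D2_rank y < D2_rank x)%N -> (D2_rank z < D2_rank x)%N -> y = z.
Proof.
have [a [k [nx dx k_ge0 _]]] := D2_coords x.
have [c [l [ny dy l_ge0 _]]] := D2_coords y.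
have [d [m [nz dz m_ge0 _]]] := D2_coords z.
rewrite (D2_edge_half nx ny) (D2_edge_half nx nz) /D2_rank.
move=> /eqP exy /eqP exz lt_yx lt_zx.
suff [eq_den eq_num] : denom y = denom z /\ c = d.
  by apply: D2_eq; rewrite // ny nz eq_num.
have := farey_neighbour_cases _ _ exy; have := farey_neighbour_cases _ _ exz.
move=> /(_ ltac:(lia) ltac:(lia)) hz /(_ ltac:(lia) ltac:(lia)) hy.
(* Over denominator 1, both lower neighbours have half-numerator one step from [a] towards 0.
   Otherwise both have smaller denominators, whose sum is even. *)
have [k0 | k_gt0] : k = 0 \/ 0 < k by lia.
  by case: hz => -[] *; case: hy => -[] *; lia.
apply: farey_neighbour_uniq exy exz; last 2 first.
- by rewrite dx; lia.
- by rewrite dy dz; lia.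
- by case: hy => -[] *; lia.
- by case: hz => -[] *; lia.
Qed.

Lemma D2_lower_neighbour_exists (x : D2) : numer x != 0 ->
  exists2 y, D2_edge x y & (D2_rank y < D2_rank x)%N.
Proof.
have [a [k [nx dx k_ge0 cak]]] := D2_coords x; rewrite nx => a_neq0.
(* As [D2_rank x] is [2 * (|a| + k) + 1], the last inequality says that the rank drops. *)
have [c [l [l_ge0 acl le_lk le_ca]]] : exists c l : int, [/\ 0 <= l,
    `|a * (2 * l + 1) - c * denom x| = 1, l <= k & `|c| + l < `|a| + k].
  have [k0 | k_gt0] : k = 0 \/ 0 < k by lia.
    by exists (a - Num.sg a), 0; rewrite dx k0; split; lia.
  rewrite dx in cak *; have [c [l [l_ge0 lt_lk acl]]] := farey_odd_neighbour k_gt0 cak.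
  exists c, l; split=> //; first lia.
  by have := farey_neighbour_cases _ _ acl => /(_ ltac:(lia) ltac:(lia)) [[]|[]|[]]; lia.
(* The determinant equation is, up to sign, a Bezout relation between [c] and [2 * l + 1]. *)
have ccl : coprimez c (2 * l + 1).
  apply/coprimezP; have [e | e] : a * (2 * l + 1) - c * denom x = 1 \/
    a * (2 * l + 1) - c * denom x = - 1 by lia.
  - by exists (- denom x, a) => /=; lia.
  - by exists (denom x, - a) => /=; lia.
have [y [ny dy]] := D2_vertex_exists l_ge0 ccl.
exists y; first by rewrite (D2_edge_half nx ny) dy acl.
by rewrite /D2_rank nx ny dx dy; lia.
Qed.

Theorem theorem1p12 : is_tree D2_edge.
Proof.
have [x0 [n0 d0]] : exists x : D2, numer x = 2 * 0 /\ denom x = 2 * 0 + 1.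
  exact: D2_vertex_exists.
split; last first.
  exact: ranked_graph_acyclic x0 D2_edge_sym D2_rank_neq D2_lower_neighbour_uniq.
apply: (@ranked_graph_connected _ _ D2_rank x0 D2_edge_sym) => x x_neq.
apply: D2_lower_neighbour_exists; apply: contra_neq x_neq => nx.
(* A positive denominator coprime to 0 equals 1, so the root 0/1 is the only vertex with numerator
   0. *)
have [a [k [na dx k_ge0 cax]]] := D2_coords x.
have a0 : a = 0 by lia.
by move: cax; rewrite a0 /coprimez gcd0z => /eqP dx1; apply: D2_eq; lia.
Qed.
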